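(* Let $\mathbf{k}$ be a field, $\beta_0,\beta_1,\gamma_0,\gamma_1\in\mathbf{k}$, $n\ge 0$, and let $\alpha$ be the evaluation of closed dotted 1-manifolds determined by these four parameters. List the $n$-diagrams as $X_1<X_2<\dots<X_N$ ($N=|\mathcal{D}_n|$) with respect to the total order on $\mathcal{D}_n$ obtained from the strict total order on the $S_n$-orbits together with an arbitrary choice of total order within each orbit, and let $G_\iota$ be the twisted Gram matrix, with $(i,j)$ entry $\alpha(\overline{\iota(X_j)}X_i)$. Then $$\det G_\iota=\prod_{\substack{A,B\ge 0\\ A+2B=n}}\left(\beta_1^{A}\gamma_1^{B}\right)^{\sum_{a+b=A,\ c+d=B}|\mathcal{O}(a,b,c,d)|},$$ where the sum in the exponent is over nonnegative integers $a,b,c,d$ with $a+b=A$ and $c+d=B$. Moreover $\det G_\iota=\pm\det G$, where $G$ is the Gram matrix with entries $\alpha(\overline{Y}X)$, $X,Y\in\mathcal{D}_n$, with respect to an order on $\mathcal{D}_n$.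
   Context: Dotted cobordisms. An (unoriented dotted) cobordism from $0$ to $n$ is a compact 1-manifold $M$ carrying finitely many interior dots, whose boundary is split into an inner part and an outer part, with a fixed bijection of the outer part with $\{1,\dots,n\}$. It is considered up to diffeomorphism rel outer boundary, so it is determined by which outer points are connected to which, the number of dots on each component, and its closed components (components without outer boundary: intervals and circles, each with some number of dots). $n$-diagrams. An $n$-diagram is such a cobordism from $0$ to $n$ with no closed components and at most one dot on each component. Each component is either a 1-arc (an interval with exactly one outer endpoint, the other endpoint being inner), also called a strand, or a 2-arc (an interval with two outer endpoints), also called a cup. Combinatorially, an $n$-diagram is a partition of $\{1,\dots,n\}$ into singletons (strands) and pairs (cups), each block being either dotless or carrying one dot. $\mathcal{D}_n$ denotes the set of $n$-diagrams. The symmetric group $S_n$ acts on $\mathcal{D}_n$ by permuting the endpoints; the orbits are the sets $\mathcal{O}(a,b,c,d)$ of all $n$-diagrams with $a$ dotless strands, $b$ dotted strands, $c$ dotless cups and $d$ dotted cups, where $a,b,c,d\ge 0$ and $a+b+2c+2d=n$. $|\mathcal{O}(a,b,c,d)|$ denotes the cardinality of the orbit. Pairing. $\overline{Y}$ is the reflection of $Y$ in a horizontal line, a cobordism from $n$ to $0$. $\overline{Y}X$ is the closed dotted 1-manifold obtained by gluing $X$ and $\overline{Y}$ along the $n$ outer points; each component is an interval or a circle, with number of dots equal to the total number of dots on the components of $X$ and $Y$ composing it. Evaluation. $\alpha$ is multiplicative under disjoint union (with value $1$ on the empty manifold); $\alpha$ equals $\beta_0$ on an interval without dots, $\beta_1$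 on an interval with one dot, $\gamma_0$ on a circle without dots, $\gamma_1$ on a circle with one dot, and $0$ on any connected interval or circle with at least two dots. Dual. $\iota(X)$ is the $n$-diagram with the same strands and cups as $X$, with dots removed from dotted components and one dot added to each dotless component. Order. For $X\in\mathcal{O}(a,b,c,d)$ put $\mathrm{def}(X)=b+d$ (number of dots) and $\mathrm{comp}(X)=a+b+c+d$ (number of components). For $\mathcal{O}=\mathcal{O}(a,b,c,d)$ and $\mathcal{O}'=\mathcal{O}(a',b',c',d')$ with $X\in\mathcal{O}$, $Y\in\mathcal{O}'$, write $\mathcal{O}<\mathcal{O}'$ if (1) $\mathrm{def}(X)>\mathrm{def}(Y)$, or (2) $\mathrm{def}(X)=\mathrm{def}(Y)$ and $\mathrm{comp}(X)<\mathrm{comp}(Y)$, or (3) $\mathrm{def}(X)=\mathrm{def}(Y)$, $\mathrm{comp}(X)=\mathrm{comp}(Y)$ and $d>d'$. This is a strict total order on the set of orbits. The total order on $\mathcal{D}_n$: $X<Y$ if the orbit of $X$ is smaller than the orbit of $Y$, or if they lie in the same orbit and $X$ precedes $Y$ in the total order arbitrarily chosen on that orbit. *)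

(* Defs.v *)
From HB Require Import structures.
From mathcomp Require Import all_boot all_order all_algebra.

Set Implicit Arguments.
Unset Strict Implicit.
Unset Printing Implicit Defensive.

Import GRing.Theory.

(* The outer points 1, ..., n are represented by 'I_n.  A pair (P, D) encodes
   the n-diagram whose components are the blocks of the partition P and whose
   dotted components are the blocks in D. *)
Definition is_diagram n (p : {set {set 'I_n}} * {set {set 'I_n}}) : bool :=
  [&& partition p.1 [set: 'I_n],
      [forall B in p.1, (#|B| == 1) || (#|B| == 2)]
    & p.2 \subset p.1].

Record diagram n := Diagram {
  diagram_val : {set {set 'I_n}} * {set {set 'I_n}};
  _ : is_diagram diagram_val
}.

HB.instance Definition _ n := [isSub for @diagram_val n].
HB.instance Definition _ n := [Finite of diagram n by <:].

Section Diagrams.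
Variable n : nat.
Implicit Types X Y : diagram n.

Definition blocks X : {set {set 'I_n}} := (val X).1.
Definition dotted X : {set {set 'I_n}} := (val X).2.
Definition strands X := [set B in blocks X | #|B| == 1].
Definition cups X := [set B in blocks X | #|B| == 2].

Lemma iota_diagram_subproof X : is_diagram (blocks X, blocks X :\: dotted X).
Proof.
have /and3P[partP cardP _] := valP X.
by rewrite /is_diagram partP cardP subsetDl.
Qed.

Definition iota_diagram X : diagram n := Diagram (iota_diagram_subproof X).

(* The quadruple (a, b, c, d) such that X lies in O(a, b, c, d). *)
Definition orbit_type X : nat * nat * nat * nat :=
  (#|strands X :\: dotted X|, #|strands X :&: dotted X|,
   #|cups X :\: dotted X|, #|cups X :&: dotted X|).

Definition orbitO (a b c d : nat) : {set diagram n} :=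
  [set X | orbit_type X == (a, b, c, d)].

End Diagrams.

Definition orbit_def (t : nat * nat * nat * nat) : nat :=
  let: (a, b, c, d) := t in b + d.

Definition orbit_comp (t : nat * nat * nat * nat) : nat :=
  let: (a, b, c, d) := t in a + b + c + d.

(* For t = (a, b, c, d), the last component t.2 is d. *)
Definition orbit_lt (t t' : nat * nat * nat * nat) : bool :=
  [|| orbit_def t > orbit_def t',
      (orbit_def t == orbit_def t') && (orbit_comp t < orbit_comp t')
    | [&& orbit_def t == orbit_def t', orbit_comp t == orbit_comp t'
        & t.2 > t'.2]].

Definition strict_total_on (T : finType) (S : {set T}) (r : rel T) : Prop :=
  [/\ {in S, irreflexive r}, {in S & &, transitive r}
    & {in S &, forall x y, x != y -> r x y || r y x}].

(* Only the restrictions of r to the individual orbits matter here, so r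
   stands for a family of relations, one on each orbit. *)
Definition diagram_lt n (r : rel (diagram n)) : rel (diagram n) :=
  fun X Y => orbit_lt (orbit_type X) (orbit_type Y)
    || (orbit_type X == orbit_type Y) && r X Y.

Variant component_shape := Interval | Circle.

(* A closed dotted 1-manifold up to diffeomorphism: the list, in some order,
   of its components, each given by its shape and its number of dots. *)
Definition closed_manifold := seq (component_shape * nat).

Section Gluing.
Variable n : nat.
Implicit Types X Y : diagram n.

Definition joined Y X : rel 'I_n :=
  fun i j => [exists B in blocks Y :|: blocks X, (i \in B) && (j \in B)].

(* A component of the glued manifold is recorded by the set of gluing points
   lying on it; there is always at least one, since diagrams have no closed
   components. *)
Definition glue_components Y X : {set {set 'I_n}} :=
  equivalence_partition (connect (joined Y X)) [set: 'I_n].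

(* The boundary of the glued manifold consists of the inner endpoints of the
   strands of X and Y, so a component is an interval iff it contains a strand. *)
Definition glue_shape Y X (C : {set 'I_n}) : component_shape :=
  if [exists B in strands Y :|: strands X, B \subset C] then Interval
  else Circle.

Definition glue_dots Y X (C : {set 'I_n}) : nat :=
  #|[set B in dotted Y | B \subset C]| + #|[set B in dotted X | B \subset C]|.

(* Reflection does not change the combinatorial data, so glue Y X takes Y
   itself and stands for the composite of X with the reflection of Y. *)
Definition glue Y X : closed_manifold :=
  [seq (glue_shape Y X C, glue_dots Y X C) | C <- enum (glue_components Y X)].

End Gluing.

Section Evaluation.
Local Open Scope ring_scope.
Variables (k : fieldType) (beta0 beta1 gamma0 gamma1 : k).

Definition eval_component (c : component_shape * nat) : k :=
  match c with
  | (Interval, 0%N) => beta0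
  | (Interval, 1%N) => beta1
  | (Circle, 0%N) => gamma0
  | (Circle, 1%N) => gamma1
  | _ => 0
  end.

Definition eval_closed (M : closed_manifold) : k :=
  \prod_(c <- M) eval_component c.

(* Here X lists the n-diagrams: it is meant to be a bijection. *)
Definition gram n N (X : 'I_N -> diagram n) : 'M[k]_N :=
  \matrix_(i, j) eval_closed (glue (X j) (X i)).

Definition twisted_gram n N (X : 'I_N -> diagram n) : 'M[k]_N :=
  \matrix_(i, j) eval_closed (glue (iota_diagram (X j)) (X i)).

End Evaluation.

(* Main.v *)
Require Import Defs.
From mathcomp Require Import all_boot all_order all_algebra perm zify.

Set Implicit Arguments.
Unset Strict Implicit.
Unset Printing Implicit Defensive.

Import GRing.Theory.
Local Open Scope ring_scope.

(** The twisted Gram matrix is lower triangular, and its determinant is the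
    product of its diagonal entries.

    Suppose that the entry pairing [X] with [iota_diagram Y] is nonzero, and
    let [K] be the number of components of the glued manifold.  A component
    with two dots or more evaluates to [0], so the total number of dots is at
    most [K]:
      [def X + (comp Y - def Y) <= K]
    ([twisted_neq0_card]).  Every component contains a block of each diagram,
    so [K <= comp X] and [K <= comp Y] ([card_glue_components]).  Therefore
    [def X <= def Y], and if [def X = def Y] then
    [comp Y <= K <= comp X].  If moreover [comp X = comp Y], every component
    consists of exactly one block of each diagram and carries exactly one dot,
    which forces [X = Y] ([twisted_neq0_eq]).  But when [X] precedes [Y] in the
    order, [def Y <= def X], and [comp X <= comp Y] if the defects agree, so
    the entry vanishes unless [X = Y] ([twisted_upper0]).

    On the diagonal, gluing [X] with its dual turns each strand into an
    interval with one dot and each cup into a circle with one dot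
    ([twisted_diag]).  Grouping the diagrams by their numbers of strands and
    cups gives the product formula.

    Since [iota_diagram] is an involution, the twisted Gram matrix is a Gram
    matrix whose rows and columns are listed by two different enumerations, so
    the two determinants agree up to the signs of two permutations
    ([det_perm_entries]). *)

(** * Partitions refining one another *)

Definition refines {T : finType} (P Q : {set {set T}}) : Prop :=
  forall B, B \in P -> exists2 C, C \in Q & B \subset C.

Lemma partition_sub_eq (T : finType) (P : {set {set T}}) (D B C : {set T}) :
  partition P D -> B \in P -> C \in P -> (B \subset C) = (B == C).
Proof.
move=> partP BP CP; have tiP := partition_trivIset partP.
apply/idP/eqP => [BC|-> //].
have /set0Pn[x xB] := partition_neq0 partP BP.
by rewrite -(def_pblock tiP BP xB) (def_pblock tiP CP (subsetP BC x xB)).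
Qed.

(** Each block of [P], hence of [S], lies in exactly one block of [Q]. *)
Lemma sum_card_refines (T : finType) (P Q S : {set {set T}}) (D : {set T}) :
    partition P D -> partition Q D -> refines P Q -> S \subset P ->
  (\sum_(C in Q) #|[set B in S | B \subset C]| = #|S|)%N.
Proof.
move=> partP partQ PQ SP.
transitivity (\sum_(C in Q) \sum_(B in S | B \subset C) 1)%N.
  by apply: eq_bigr => C _; rewrite sum1dep_card.
rewrite (exchange_big_dep (mem S)) //=; last by move=> C B _ /andP[].
rewrite -sum1_card; apply: eq_bigr => B BS.
have BP := subsetP SP B BS; have [C CQ BC] := PQ B BP.
have tiQ := partition_trivIset partQ.
have /set0Pn[x xB] := partition_neq0 partP BP.
rewrite (big_pred1 C) // => C' /=; rewrite BS /=.
apply/andP/eqP => [[C'Q BC']|-> //].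
rewrite -(def_pblock tiQ CQ (subsetP BC x xB)).
by rewrite (def_pblock tiQ C'Q (subsetP BC' x xB)).
Qed.

Lemma refines_pblock_sub (T : finType) (P Q : {set {set T}}) (D C : {set T}) x :
    partition P D -> partition Q D -> refines P Q -> C \in Q -> x \in C ->
  pblock P x \in [set B in P | B \subset C].
Proof.
move=> partP partQ PQ CQ xC; have /and3P[/eqP cQ tiQ _] := partQ.
have xP : x \in cover P.
  by rewrite (cover_partition partP) -cQ; apply/bigcupP; exists C.
rewrite inE pblock_mem //=.
have [C' C'Q PC'] := PQ _ (pblock_mem xP).
have xC' : x \in C' by rewrite (subsetP PC') // mem_pblock.
by rewrite -(def_pblock tiQ CQ xC) (def_pblock tiQ C'Q xC').
Qed.

Lemma refines_card_gt0 (T : finType) (P Q : {set {set T}}) (D C : {set T}) :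
    partition P D -> partition Q D -> refines P Q -> C \in Q ->
  (0 < #|[set B in P | B \subset C]|)%N.
Proof.
move=> partP partQ PQ CQ; have /set0Pn[x xC] := partition_neq0 partQ CQ.
by apply/card_gt0P; exists (pblock P x); apply: refines_pblock_sub partQ _ CQ _.
Qed.

Lemma refines_leq_card (T : finType) (P Q : {set {set T}}) (D : {set T}) :
  partition P D -> partition Q D -> refines P Q -> (#|Q| <= #|P|)%N.
Proof.
move=> partP partQ PQ.
rewrite -(sum_card_refines partP partQ PQ (subxx P)) -sum1_card.
by apply: leq_sum => C CQ; apply: refines_card_gt0 partQ _ CQ.
Qed.

(** The blocks of [P] contained in a block of [Q] are at least one in number,
    and they sum to [#|P| = #|Q|]; hence each block of [Q] contains exactly one
    block of [P], which must fill it. *)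
Lemma refines_card_eq (T : finType) (P Q : {set {set T}}) (D : {set T}) :
  partition P D -> partition Q D -> refines P Q -> #|P| = #|Q| -> Q = P.
Proof.
move=> partP partQ PQ eqPQ; apply/eqP; rewrite eqEcard eqPQ leqnn andbT.
have := sum_card_refines partP partQ PQ (subxx P).
rewrite eqPQ -sum1_card => /esym/eqP.
have leC C : C \in Q -> (1 <= #|[set B in P | B \subset C]|
    ?= iff (1%N == #|[set B in P | B \subset C]|))%N.
  by move=> CQ; split=> //; apply: refines_card_gt0 partQ _ CQ.
rewrite (leqif_sum leC) => /forall_inP one.
apply/subsetP => C CQ; move: (one C CQ); rewrite eq_sym => /cards1P[B BE].
have: B \in [set B' in P | B' \subset C] by rewrite BE set11.
rewrite inE => /andP[BP BC]; suff -> : C = B by [].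
apply/eqP; rewrite eqEsubset BC andbT; apply/subsetP => x xC.
have := refines_pblock_sub partP partQ PQ CQ xC.
rewrite BE inE => /eqP <-; rewrite mem_pblock (cover_partition partP).
by rewrite -(cover_partition partQ); apply/bigcupP; exists C.
Qed.

(** * Statistics of a diagram *)

Section Statistics.
Variable n : nat.
Implicit Types X Y : diagram n.

Lemma blocks_partition X : partition (blocks X) [set: 'I_n].
Proof. by have /and3P[] := valP X. Qed.

Lemma dotted_sub X : dotted X \subset blocks X.
Proof. by have /and3P[] := valP X. Qed.

Lemma diagram_eq X Y : blocks X = blocks Y -> dotted X = dotted Y -> X = Y.
Proof.
by move=> eqb eqd; apply/val_inj/injective_projections.
Qed.

Lemma cups_blocksD X : cups X = blocks X :\: strands X.
Proof.
apply/setP => B; rewrite !inE; case BX: (B \in blocks X); rewrite ?andbF //=.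
have /and3P[_ /forall_inP/(_ B BX) + _] := valP X.
by rewrite andbT; case/orP=> /eqP ->.
Qed.

Lemma strands_sub X : strands X \subset blocks X.
Proof. by apply/subsetP => B; rewrite inE => /andP[]. Qed.

Lemma card_blocks X : #|blocks X| = (#|strands X| + #|cups X|)%N.
Proof.
by rewrite cups_blocksD -(cardsID (strands X)) (setIidPr (strands_sub X)).
Qed.

(** The [n] outer points are distributed over the blocks, one on each strand
    and two on each cup. *)
Lemma card_strands_cups X : (#|strands X| + 2 * #|cups X|)%N = n.
Proof.
have := card_partition (blocks_partition X); rewrite cardsT card_ord => nE.
rewrite [RHS]nE (big_setID (strands X)) /= (setIidPr (strands_sub X)) -cups_blocksD.
rewrite (eq_bigr (fun=> 1%N)) ?sum1_card; last first.
  by move=> B; rewrite inE => /andP[_ /eqP].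
rewrite [X in (_ = _ + X)%N](eq_bigr (fun=> 2)) ?sum_nat_const 1?mulnC //.
by move=> B; rewrite inE => /andP[_ /eqP].
Qed.

Lemma orbit_comp_card X : orbit_comp (orbit_type X) = #|blocks X|.
Proof.
rewrite /orbit_comp /orbit_type card_blocks -(cardsID (dotted X) (strands X)).
by rewrite -(cardsID (dotted X) (cups X)); lia.
Qed.

Lemma orbit_def_card X : orbit_def (orbit_type X) = #|dotted X|.
Proof.
rewrite /= -(cardsID (strands X) (dotted X)) cups_blocksD ![_ :&: dotted X]setIC.
by rewrite setIDA (setIidPl (dotted_sub X)).
Qed.

Lemma blocks_iota X : blocks (iota_diagram X) = blocks X.
Proof. by []. Qed.

Lemma dotted_iota X : dotted (iota_diagram X) = blocks X :\: dotted X.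
Proof. by []. Qed.

Lemma strands_iota X : strands (iota_diagram X) = strands X.
Proof. by []. Qed.

Lemma iotaK : involutive (@iota_diagram n).
Proof.
move=> X; apply: diagram_eq => //.
by rewrite !dotted_iota blocks_iota setDDr setDv set0U (setIidPr (dotted_sub X)).
Qed.

End Statistics.

(** * Components of a glued manifold *)

Section GlueComponents.
Variable n : nat.
Implicit Types X Y : diagram n.

Lemma joined_sym Y X : symmetric (joined Y X).
Proof. by move=> i j; apply: eq_existsb => B; rewrite [X in _ && X]andbC. Qed.

Lemma glue_connect_equiv Y X : 
  {in [set: 'I_n] & &, equivalence_rel (connect (joined Y X))}.
Proof.
move=> i j l _ _ _; split=> [|ij]; first exact: connect0.
by rewrite (same_connect (sym_connect_sym (joined_sym Y X)) ij).
Qed.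

Lemma glue_components_partition Y X :
  partition (glue_components Y X) [set: 'I_n].
Proof. exact: equivalence_partitionP (@glue_connect_equiv Y X). Qed.

Lemma blocks_refine_glue Y X B :
    B \in blocks Y :|: blocks X ->
  exists2 C, C \in glue_components Y X & B \subset C.
Proof.
move=> BYX; have B0 : B != set0.
  move: BYX; rewrite inE => /orP[] BY;
    by rewrite (partition_neq0 (blocks_partition _) BY).
have /set0Pn[x xB] := B0.
have /and3P[/eqP cQ _ _] := glue_components_partition Y X.
exists (pblock (glue_components Y X) x).
  by rewrite pblock_mem // cQ.
apply/subsetP => y yB.
rewrite (pblock_equivalence_partition (@glue_connect_equiv Y X)) //.
by apply/connect1/existsP; exists B; rewrite BYX xB.
Qed.

Lemma glue_refines_bottom Y X : refines (blocks Y) (glue_components Y X).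
Proof. by move=> B BY; apply: blocks_refine_glue; rewrite inE BY. Qed.

Lemma glue_refines_top Y X : refines (blocks X) (glue_components Y X).
Proof. by move=> B BX; apply: blocks_refine_glue; rewrite inE BX orbT. Qed.

(** No dot is lost or counted twice in gluing, because every block lies on
    exactly one component. *)
Lemma sum_glue_dots Y X :
  (\sum_(C in glue_components Y X) glue_dots Y X C = #|dotted Y| + #|dotted X|)%N.
Proof.
rewrite big_split /=; have partQ := glue_components_partition Y X.
rewrite (sum_card_refines (blocks_partition Y) partQ) ?dotted_sub //;
  last exact: glue_refines_bottom.
rewrite (sum_card_refines (blocks_partition X) partQ) ?dotted_sub //.
exact: glue_refines_top.
Qed.

Lemma glue_dots_block Y X C :
    blocks Y = blocks X -> C \in blocks X ->
  glue_dots Y X C = ((C \in dotted Y) + (C \in dotted X))%N.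
Proof.
move=> eqb CX; have one (Z : diagram n) : C \in blocks Z ->
    #|[set B in dotted Z | B \subset C]| = (C \in dotted Z).
  move=> CZ; have -> : [set B in dotted Z | B \subset C]
      = if C \in dotted Z then [set C] else set0.
    apply/setP => B; rewrite inE.
    have [BZ|BZ] := boolP (B \in dotted Z); last first.
      by case: ifP => CD; rewrite !inE //; apply/esym; apply: contraNF BZ => /eqP ->.
    have B'Z := subsetP (dotted_sub Z) B BZ.
    rewrite (partition_sub_eq (blocks_partition Z)) //.
    by case: ifP => CD; rewrite !inE //; apply: contraFF CD => /eqP <-.
  by case: ifP; rewrite ?cards1 ?cards0.
by rewrite /glue_dots !one ?eqb.
Qed.

(** With equal underlying partitions, two points are joined only when they
    share a block, so walking along the glued manifold never leaves a block. *)
Lemma glue_components_same Y X :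
  blocks Y = blocks X -> glue_components Y X = blocks X.
Proof.
move=> eqb; have partX := blocks_partition X.
have /and3P[/eqP cX tiX _] := partX.
rewrite -[RHS](equivalence_partition_pblock partX).
apply: eq_in_imset => x _; apply/setP => y; rewrite !inE /=.
have xB : x \in pblock (blocks X) x by rewrite mem_pblock cX.
have BX : pblock (blocks X) x \in blocks X by rewrite pblock_mem // cX.
apply/idP/idP => [xy|yB]; last first.
  by apply/connect1/existsP; exists (pblock (blocks X) x); rewrite inE BX orbT xB.
rewrite -(closed_connect _ xy) //.
apply: (intro_closed (sym_connect_sym (joined_sym Y X))) => i j.
case/existsP=> B; rewrite inE eqb orbb => /and3P[B'X iB jB] iX.
by rewrite -(def_pblock tiX BX iX) (def_pblock tiX B'X iB).
Qed.

End GlueComponents.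

(** * The twisted pairing *)

Section Pairing.
Variables (k : fieldType) (beta0 beta1 gamma0 gamma1 : k) (n : nat).
Implicit Types X Y : diagram n.

Local Notation eval := (eval_closed beta0 beta1 gamma0 gamma1).

Lemma eval_glueE Y X :
  eval (glue Y X) = \prod_(C in glue_components Y X)
    eval_component beta0 beta1 gamma0 gamma1 (glue_shape Y X C, glue_dots Y X C).
Proof. by rewrite /eval_closed /glue big_map big_enum. Qed.

(** The evaluation is a product in a field, and a component with two dots or
    more contributes the factor [0]. *)
Lemma eval_neq0_dots Y X C :
    eval (glue Y X) != 0 -> C \in glue_components Y X ->
  (glue_dots Y X C <= 1)%N.
Proof.
rewrite eval_glueE => /prodf_neq0 + CQ => /(_ C CQ).
by case: (glue_shape Y X C); case: (glue_dots Y X C) => [|[|m]] //=;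
  rewrite eqxx.
Qed.

Lemma card_dotted_iota Y : (#|dotted (iota_diagram Y)| + #|dotted Y| = #|blocks Y|)%N.
Proof. 
by rewrite dotted_iota -(cardsID (dotted Y) (blocks Y)) (setIidPr (dotted_sub Y)) addnC.
Qed.

(** The left-hand side, once [#|dotted Y|] is subtracted, is the total number
    of dots of the glued manifold; there is at most one dot per component. *)
Lemma twisted_neq0_card Y X :
    eval (glue (iota_diagram Y) X) != 0 ->
  (#|blocks Y| + #|dotted X| <= #|glue_components (iota_diagram Y) X| + #|dotted Y|)%N.
Proof.
move=> nz; rewrite -card_dotted_iota addnAC leq_add2r -sum_glue_dots -sum1_card.
by apply: leq_sum => C CQ; apply: eval_neq0_dots nz CQ.
Qed.

Lemma card_glue_components Y X :
  (#|glue_components Y X| <= #|blocks Y|)%N /\ (#|glue_components Y X| <= #|blocks X|)%N.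
Proof.
have partQ := glue_components_partition Y X; split.
  exact: refines_leq_card (blocks_partition Y) partQ (@glue_refines_bottom _ Y X).
exact: refines_leq_card (blocks_partition X) partQ (@glue_refines_top _ Y X).
Qed.

(** The two bounds on the number of components become equalities, so the
    components are the common blocks of [X] and [Y].  There are then as many
    dots as components, and at most one dot on each, hence exactly one: a block
    is dotted in [X] iff it is not dotted in the dual of [Y], that is, iff it is
    dotted in [Y]. *)
Lemma twisted_neq0_eq Y X :
    eval (glue (iota_diagram Y) X) != 0 ->
    #|dotted X| = #|dotted Y| -> #|blocks X| = #|blocks Y| -> X = Y.
Proof.
move=> nz eqd eqb; have le := twisted_neq0_card nz.
have [leY leX] := card_glue_components (iota_diagram Y) X.
have partQ := glue_components_partition (iota_diagram Y) X.
rewrite blocks_iota in leY.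
have eqQ : #|glue_components (iota_diagram Y) X| = #|blocks Y| by lia.
have QX : glue_components (iota_diagram Y) X = blocks X.
  apply: refines_card_eq (blocks_partition X) partQ (@glue_refines_top _ _ X) _.
  by rewrite eqQ.
have QY : glue_components (iota_diagram Y) X = blocks Y.
  exact: refines_card_eq (blocks_partition Y) partQ
    (@glue_refines_bottom _ (iota_diagram Y) X) (esym eqQ).
have bXY : blocks X = blocks Y by rewrite -QX.
apply: diagram_eq => //.
have leC C : C \in glue_components (iota_diagram Y) X ->
    (glue_dots (iota_diagram Y) X C <= 1
      ?= iff (glue_dots (iota_diagram Y) X C == 1))%N.
  by move=> CQ; split=> //; apply: eval_neq0_dots nz CQ.
have := (leqif_sum leC).2; rewrite sum_glue_dots sum1_card eqQ eqd.
rewrite card_dotted_iota eqxx => /esym/forall_inP one.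
apply/setP => C; have [CX|CX] := boolP (C \in blocks X); last first.
  by rewrite !(contraNF (subsetP (dotted_sub _) C)) -?bXY.
move: (one C); rewrite QX CX glue_dots_block // => /(_ isT).
rewrite dotted_iota inE -bXY CX andbT.
by case: (C \in dotted Y); case: (C \in dotted X).
Qed.

(** If the entry is nonzero, the bounds above give [def X <= def Y], and
    [comp Y <= comp X] when the defects agree, while [X < Y] gives the reverse
    inequalities; so [twisted_neq0_eq] applies. *)
Lemma twisted_upper0 (r : rel (diagram n)) Y X :
  diagram_lt r X Y -> X != Y -> eval (glue (iota_diagram Y) X) = 0.
Proof.
move=> lt; apply: contraNeq => nz.
have le := twisted_neq0_card nz.
have [leY leX] := card_glue_components (iota_diagram Y) X.
rewrite blocks_iota in leY.
have [led lec] : (#|dotted Y| <= #|dotted X|)%N /\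
    (#|dotted X| = #|dotted Y| -> #|blocks X| <= #|blocks Y|)%N.
  rewrite -!orbit_def_card -!orbit_comp_card.
  case/orP: lt => [|/andP[/eqP-> _]]; last by [].
  case/or3P => [lt|/andP[/eqP -> /ltnW]|/and3P[/eqP -> /eqP -> _]] //.
  by split; lia.
have eqd : #|dotted X| = #|dotted Y| by lia.
by apply/eqP/twisted_neq0_eq => //; have := lec eqd; lia.
Qed.

(** The components are the blocks of [X], each dotted in exactly one of [X] and
    its dual. *)
Lemma twisted_diag X :
  eval (glue (iota_diagram X) X) = beta1 ^+ #|strands X| * gamma1 ^+ #|cups X|.
Proof.
rewrite eval_glueE glue_components_same //.
rewrite (big_setID (strands X)) /= (setIidPr (strands_sub X)) -cups_blocksD.
have dots C : C \in blocks X -> glue_dots (iota_diagram X) X C = 1%N.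
  move=> CX; rewrite glue_dots_block // dotted_iota inE CX andbT.
  by case: (C \in dotted X).
have shape C : C \in blocks X -> glue_shape (iota_diagram X) X C =
    if C \in strands X then Defs.Interval else Circle.
  move=> CX; rewrite /glue_shape strands_iota setUid.
  congr (if _ then _ else _); apply/existsP/idP => [[B /andP[BX BC]]|CS].
    move: BC; rewrite (partition_sub_eq (blocks_partition X)) //.
      by move/eqP <-.
    exact: subsetP (strands_sub X) B BX.
  by exists C; rewrite CS subxx.
rewrite (eq_bigr (fun=> beta1)); last first.
  by move=> C CS; have CX := subsetP (strands_sub X) C CS; rewrite shape // dots // CS.
rewrite [X in _ * X](eq_bigr (fun=> gamma1)) ?prodr_const // => C.
by rewrite cups_blocksD inE => /andP[/negPf CS CX]; rewrite shape // dots // CS.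
Qed.

End Pairing.

(** * Determinants *)

(** Row and column permutations may differ, so the determinant can change by
    the product of their signs. *)
Lemma det_perm_entries (k : comNzRingType) (N : nat) (A B : 'M[k]_N)
    (s t : 'S_N) :
  (forall i j, A i j = B (s i) (t j)) ->
  \det A = \det B \/ \det A = - \det B.
Proof.
move=> AB; have -> : A = row_perm s (col_perm t B).
  by apply/matrixP => i j; rewrite !mxE.
rewrite row_permE col_permE !det_mulmx !det_perm [\det B * _]mulrC mulrA.
by rewrite -signr_addb; case: (_ (+) _); [right | left];
  rewrite ?expr1 ?mulN1r ?expr0 ?mul1r.
Qed.

Lemma reindex_perm (T : Type) (N : nat) (f g : 'I_N -> T) :
  bijective f -> bijective g -> exists s : 'S_N, forall i, f i = g (s i).
Proof.
move=> bij_f [h gK hK]; have inj : injective (h \o f).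
  exact: inj_comp (can_inj hK) (bij_inj bij_f).
by exists (perm inj) => i; rewrite permE /= hK.
Qed.

(** * Counting diagrams by strands and cups *)

(** Splits a finite iterated operation according to a pair of bounded numerical
    statistics, in the nested form in which the exponents of the determinant
    formula are written. *)
Lemma partition_big_nat2 (R : Type) (idx : R) (op : Monoid.com_law idx)
    (T : finType) (S : {set T}) (f g : T -> nat) (Q : rel nat) M N (F : T -> R) :
    (forall x, x \in S -> [&& f x <= M, g x <= N & Q (f x) (g x)])%N ->
  \big[op/idx]_(x in S) F x =
    \big[op/idx]_(a < M.+1) \big[op/idx]_(b < N.+1 | Q a b)
      \big[op/idx]_(x in [set x in S | (f x == a) && (g x == b)]) F x.
Proof.
move=> fgP; rewrite (partition_big (fun x => inord (f x) : 'I_M.+1) xpredT) //=.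
apply: eq_bigr => a _.
rewrite (partition_big (fun x => inord (g x) : 'I_N.+1) (fun b => Q a b)) /=.
  apply: eq_bigr => b _; apply: eq_bigl => x; rewrite inE.
  have [/fgP/and3P[fM gN _]|//] := boolP (x \in S).
  by rewrite -!val_eqE /= !inordK.
by move=> x /andP[/fgP/and3P[fM gN fgQ] /eqP <-]; rewrite !inordK.
Qed.

Arguments partition_big_nat2 {R idx op T S} f g Q M N F _.

Lemma sum_orbitO n A B :
  (\sum_(a < A.+1) \sum_(b < A.+1 | (a + b == A)%N)
     \sum_(c < B.+1) \sum_(d < B.+1 | (c + d == B)%N) #|orbitO n a b c d|
   = #|[set X : diagram n | (#|strands X| == A) && (#|cups X| == B)]|)%N.
Proof.
rewrite -[RHS]sum1_card.
rewrite (partition_big_nat2 (fun X => #|strands X :\: dotted X|)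
  (fun X => #|strands X :&: dotted X|) (fun a b => (a + b == A)%N) A A); last first.
  (* Only beta: simplification would change the form of the cardinals, which
     lia treats as atoms. *)
  move=> X; cbv beta; rewrite inE -(cardsID (dotted X) (strands X)) => /andP[/eqP <- _].
  lia.
cbv beta; apply: eq_bigr => a _; apply: eq_bigr => b /eqP abA.
rewrite (partition_big_nat2 (fun X => #|cups X :\: dotted X|)
  (fun X => #|cups X :&: dotted X|) (fun c d => (c + d == B)%N) B B); last first.
  move=> X; cbv beta; rewrite !inE -(cardsID (dotted X) (cups X)).
  by move=> /andP[/andP[_ /eqP <-] _]; lia.
cbv beta; apply: eq_bigr => c _; apply: eq_bigr => d /eqP cdB.
rewrite sum1_card; congr #|pred_of_set _|; apply/setP => X.
rewrite !inE -(cardsID (dotted X) (strands X)) -(cardsID (dotted X) (cups X)).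
by rewrite /orbit_type !xpair_eqE; lia.
Qed.

Lemma prod_by_strands_cups (R : comNzRingType) (x y : R) n :
  \prod_(X : diagram n) (x ^+ #|strands X| * y ^+ #|cups X|) =
  \prod_(A < n.+1) \prod_(B < n.+1 | (A + 2 * B == n)%N)
    (x ^+ A * y ^+ B)
      ^+ #|[set X : diagram n | (#|strands X| == A) && (#|cups X| == B)]|.
Proof.
rewrite -(eq_bigl _ _ (in_setT (T := diagram n))).
rewrite (partition_big_nat2 (fun X => #|strands X|) (fun X => #|cups X|)
  (fun A B => (A + 2 * B == n)%N) n n); last first.
  by move=> X _; cbv beta; have := card_strands_cups X; lia.
apply: eq_bigr => A _; apply: eq_bigr => B _.
rewrite -prodr_const; apply: eq_big => [X|X]; rewrite !inE //=.
by case/andP=> /eqP -> /eqP ->.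
Qed.

Theorem mainTheorem4 (k : fieldType) (beta0 beta1 gamma0 gamma1 : k) (n : nat)
    (r : rel (diagram n))
    (r_total : forall a b c d : nat, strict_total_on (orbitO n a b c d) r)
    (X : 'I_#|{: diagram n}| -> diagram n)
    (X_bij : bijective X)
    (X_incr : forall i j : 'I_#|{: diagram n}|,
       (i < j)%N -> diagram_lt r (X i) (X j)) :
  \det (twisted_gram beta0 beta1 gamma0 gamma1 X)
    = \prod_(A < n.+1) \prod_(B < n.+1 | (A + 2 * B == n)%N)
        (beta1 ^+ A * gamma1 ^+ B)
          ^+ (\sum_(a < A.+1) \sum_(b < A.+1 | (a + b == A)%N)
               \sum_(c < B.+1) \sum_(d < B.+1 | (c + d == B)%N)
                 #|orbitO n a b c d|)%N
  /\ (forall Z : 'I_#|{: diagram n}| -> diagram n, bijective Z ->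
        \det (twisted_gram beta0 beta1 gamma0 gamma1 X)
          = \det (gram beta0 beta1 gamma0 gamma1 Z)
        \/ \det (twisted_gram beta0 beta1 gamma0 gamma1 X)
          = - \det (gram beta0 beta1 gamma0 gamma1 Z)).
Proof.
split=> [|Z Z_bij]; last first.
  have [s sE] := reindex_perm X_bij Z_bij.
  have iX_bij : bijective (@iota_diagram n \o X).
    exact: bij_comp (inv_bij (@iotaK n)) X_bij.
  have [t tE] := reindex_perm iX_bij Z_bij.
  by apply: (@det_perm_entries _ _ _ _ s t) => i j; rewrite !mxE -sE -tE.
rewrite det_trig; last first.
  apply/is_trig_mxP => i j ij; rewrite mxE.
  apply: twisted_upper0 (X_incr _ _ ij) _.
  by apply: contraTneq ij => /(bij_inj X_bij) ->; rewrite ltnn.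
transitivity (\prod_(Y : diagram n) (beta1 ^+ #|strands Y| * gamma1 ^+ #|cups Y|)).
  rewrite (reindex X) /=; last exact: onW_bij.
  by apply: eq_bigr => i _; rewrite mxE twisted_diag.
rewrite prod_by_strands_cups; apply: eq_bigr => A _; apply: eq_bigr => B _.
by rewrite sum_orbitO.
Qed.
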